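(* Every two-colouring of the edges of the complete graph $K_n$ contains a monochromatic circuit (and hence a monochromatic trail) of length at least $2n^2/9 + O(n^{3/2})$. Moreover, this is asymptotically tight: for every $n$ there is a two-colouring of the edges of $K_n$ in which every monochromatic trail and every monochromatic circuit has length at most $2n^2/9 + o(n^2)$.
   Context: A trail in a graph is a walk with no repeated edges; a circuit is a closed trail, i.e. a trail whose first and last vertices coincide. The length of a trail or circuit is its number of edges. A monochromatic trail or circuit is one all of whose edges have the same colour. The $O(n^{3/2})$ term denotes a quantity bounded in absolute value by $C n^{3/2}$ for an absolute constant $C$ and all $n$. *)

(* Defs.v *)
From HB Require Import structures.
From mathcomp Require Import all_boot all_order all_algebra.
From mathcomp Require Import all_classical all_reals all_analysis.

Set Implicit Arguments.
Unset Strict Implicit.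
Unset Printing Implicit Defensive.

Import Order.TTheory GRing.Theory Num.Theory.
Import numFieldNormedType.Exports.

(* A simple graph on T is a symmetric irreflexive e : rel T. The walk with
   vertex sequence x :: p has edges walk_edges x p, hence length size p. *)
Section Trails.
Variables (T : finType) (e : rel T).

Definition walk_edges (x : T) (p : seq T) : seq {set T} :=
  pairmap (fun u v => [set u; v]%SET) x p.

Definition is_trail (x : T) (p : seq T) : bool :=
  path e x p && uniq (walk_edges x p).

Definition is_circuit (x : T) (p : seq T) : bool :=
  is_trail x p && (last x p == x).

End Trails.

Definition complete_graph (n : nat) : rel 'I_n := [rel u v | u != v].

(* Edges of K_n are the sets [set u; v] with u != v; the values of a colouring
   on other subsets of 'I_n play no role. *)
Definition two_colouring (n : nat) : Type := {set 'I_n} -> bool.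

Definition monochromatic (n : nat) (c : two_colouring n)
    (x : 'I_n) (p : seq 'I_n) : bool :=
  constant [seq c f | f <- walk_edges x p].

Definition mono_trail (n : nat) (c : two_colouring n)
    (x : 'I_n) (p : seq 'I_n) : bool :=
  is_trail (@complete_graph n) x p && monochromatic c x p.

Definition mono_circuit (n : nat) (c : two_colouring n)
    (x : 'I_n) (p : seq 'I_n) : bool :=
  is_circuit (@complete_graph n) x p && monochromatic c x p.

(* Main.v *)
(* Lower bound.  Deleting at most n edges from each colour class makes all its
   degrees even, so every monochromatic component becomes a circuit, and at
   most 2n edges are lost in total.  Two vertices that share neither a red nor
   a blue component form a lost edge; hence some component, say a red one,
   misses only O(sqrt n) vertices.  If it has fewer than 2n^2/9 edges, then the
   red graph has at most 2n^2/9 + O(n^{3/2}) edges, among which are all but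
   O(n) of the pairs separated by the blue components.  This forces a blue
   component with at least 2n/3 - O(sqrt n) vertices, and the other blue
   components then contain at most n^2/18 + O(n^{3/2}) edges, which leaves
   2n^2/9 - O(n^{3/2}) edges for the large one.
   Upper bound.  Colour red two disjoint cliques on 2n/3 and n/3 vertices and
   colour blue the complete bipartite graph between them. *)
Require Import Defs.
From HB Require Import structures.
From mathcomp Require Import all_boot all_order all_algebra.
From mathcomp Require Import all_classical all_reals all_analysis.
From mathcomp Require Import zify ring lra.

Import Order.TTheory GRing.Theory Num.Theory.
Import numFieldNormedType.Exports.

Set Implicit Arguments.
Unset Strict Implicit.
Unset Printing Implicit Defensive.

(** * Even subgraphs obtained by deleting few edges *)

Section EvenGraphs.
Import mathcomp.boot.fintype mathcomp.boot.finset.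
Variable T : finType.
Implicit Types (F D X Y : {set {set T}}) (f : {set T}).

Definition edge_rel F : rel T := [rel u v | (u != v) && ([set u; v]%SET \in F)].

Definition edge_deg F (v : T) := #|[set f in F | v \in f]%SET|.

Definition even_graph F := [forall v, ~~ odd (edge_deg F v)].

Definition edge_symdiff X Y := ((X :\: Y) :|: (Y :\: X))%SET.

Lemma edge_rel_sym F : symmetric (edge_rel F).
Proof. by move=> u v; rewrite /edge_rel /= eq_sym setUC. Qed.

Lemma edge_degE F v : edge_deg F v = \sum_(f in F) (v \in f).
Proof.
rewrite /edge_deg -sum1_card big_mkcond [RHS]big_mkcond /=.
by apply: eq_bigr => f _; rewrite inE; case: (f \in F); case: (v \in f).
Qed.

Lemma odd_edge_deg_symdiff X Y v :
  odd (edge_deg (edge_symdiff X Y) v) = odd (edge_deg X v) (+) odd (edge_deg Y v).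
Proof.
pose A := [set f in X | v \in f]%SET; pose B := [set f in Y | v \in f]%SET.
have -> : edge_deg (edge_symdiff X Y) v = #|A :\: B| + #|B :\: A|.
  rewrite -cardsUI (_ : (_ :&: _)%SET = set0) ?cards0 ?addn0; last first.
    by apply/setP => f; rewrite !inE; case: (f \in X); case: (f \in Y); case: (v \in f).
  apply: eq_card => f; rewrite !inE.
  by case: (f \in X); case: (f \in Y); case: (v \in f).
have := cardsID B A; have := cardsID A B; rewrite (setIC B) /edge_deg -/A -/B.
by move=> <- <-; rewrite !oddD; do 3!case: odd.
Qed.

(* There are more subsets of D than parity vectors on T, so two of them have
   the same degree parities; their symmetric difference is even. *)
Lemma exists_even_subgraph D : #|T| < #|D| ->
  exists Z : {set {set T}}, [/\ Z \subset D, Z != set0 & even_graph Z].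
Proof.
move=> ltTD.
pose par X := [set v | odd (edge_deg X v)]%SET.
case: (boolP (dinjectiveb par (powerset D))) => [/dinjectiveP inj|].
  have := max_card (par @: powerset D)%SET.
  rewrite (card_in_imset inj) card_powerset -cardsT -powersetT card_powerset cardsT leq_exp2l //.
  by rewrite leqNgt ltTD.
case/dinjectivePn => X XD [Y]; rewrite !inE => /andP[neqYX YD] parE.
rewrite powersetE in XD.
exists (edge_symdiff X Y); split.
- by apply/subsetP => f; rewrite !inE => /orP[] /andP[_]; apply: subsetP.
- apply: contra neqYX => /eqP sd0; apply/eqP/setP => f.
  by move/setP/(_ f): sd0; rewrite !inE; case: (f \in X); case: (f \in Y).
- apply/forallP => v; rewrite odd_edge_deg_symdiff.
  by move/setP/(_ v): parE; rewrite !inE => ->; rewrite addbb.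
Qed.

(** Take an even subgraph [X] of maximal size. If more than [#|T|] edges were left over, they would
    contain a nonempty even [Z]; it is disjoint from [X], so adding it would give a larger even
    subgraph. *)
Lemma large_even_subgraph F :
  exists X, [/\ X \subset F, even_graph X & #|F :\: X| <= #|T|].
Proof.
pose P X := (X \subset F) && even_graph X.
have P0 : P set0.
  rewrite /P sub0set; apply/forallP => v.
  by rewrite edge_degE big_set0.
case: (@arg_maxnP _ set0 P (fun X => #|X|) P0) => X /andP[XF evX] maxX.
exists X; split => //; rewrite leqNgt; apply/negP => /exists_even_subgraph.
case=> Z [ZD Z0 evZ].
have /subsetP ZDm := ZD.
have := maxX (edge_symdiff X Z); rewrite /P.
have -> : (edge_symdiff X Z \subset F).
  apply/subsetP => f; rewrite !inE => /orP[] /andP[_].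
    exact: (subsetP XF).
  by move/ZDm; rewrite inE => /andP[].
have -> /= : even_graph (edge_symdiff X Z).
  apply/forallP => v; rewrite odd_edge_deg_symdiff.
  by rewrite (negbTE (forallP evX v)) (negbTE (forallP evZ v)).
move=> /(_ isT); apply/negP; rewrite -ltnNge; apply: proper_card.
have/set0Pn[z zZ] := Z0.
have := ZDm _ zZ; rewrite inE => /andP[zX zF].
apply/properP; split; last by exists z; rewrite // !inE zX zZ orbT.
apply/subsetP => f fX; rewrite !inE fX andbT orbC /=.
by apply: contraL fX => /ZDm; rewrite inE => /andP[].
Qed.

(** * Walks, trails and Euler circuits *)

Lemma walk_edges_cat x (p q : seq T) :
  walk_edges x (p ++ q) = walk_edges x p ++ walk_edges (last x p) q.
Proof. exact: pairmap_cat. Qed.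

Lemma size_walk_edges x (p : seq T) : size (walk_edges x p) = size p.
Proof. exact: size_pairmap. Qed.

Lemma walk_edges_sub F x p : path (edge_rel F) x p ->
  {subset walk_edges x p <= F}.
Proof.
elim: p x => //= y p IHp x /andP[/andP[_ xyF] yp] f; rewrite inE.
by case/predU1P => [->|/(IHp _ yp)].
Qed.

Lemma walk_edges_vertices x (p : seq T) f v :
  f \in walk_edges x p -> v \in f -> v \in x :: p.
Proof.
elim: p x => //= y p IHp x; rewrite inE => /predU1P[->|fp vf].
  by rewrite !inE => /orP[] ->; rewrite ?orbT.
by rewrite inE (IHp y) ?orbT.
Qed.

(** Each passage through [v] uses two edges, so only the two ends of the walk affect the parity. *)
Lemma odd_count_walk_edges (e : rel T) x p v : irreflexive e -> path e x p ->
  odd (count (fun f : {set T} => v \in f) (walk_edges x p)) =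
  (v == x) (+) (v == last x p).
Proof.
move=> irr; elim: p x => [|y p IHp] x /=; first by rewrite addbb.
case/andP=> exy /IHp yp; rewrite oddD yp oddb !inE.
case: (eqVneq v x) => [->|_] /=; last by case: (v == y); case: (v == last y p).
case: eqVneq exy => [->|_ _] /=; first by rewrite irr.
by [].
Qed.

Lemma edge_rel_irr F : irreflexive (edge_rel F).
Proof. by move=> x; rewrite /edge_rel /= eqxx. Qed.

Lemma is_circuit_rot (e : rel T) x p y : is_circuit e x p -> y \in x :: p ->
  exists2 q, is_circuit e y q & size q = size p /\ walk_edges y q =i walk_edges x p.
Proof.
move=> /andP[/andP[ep uq] /eqP lx] yp.
case/splitPl: yp ep uq lx => p1 p2 lp1.
rewrite cat_path walk_edges_cat last_cat lp1 => /andP[ep1 ep2] uq lp2.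
exists (p2 ++ p1).
  rewrite /is_circuit /is_trail cat_path ep2 lp2 ep1 walk_edges_cat lp2.
  by rewrite uniq_catC uq last_cat lp2 lp1 /=.
split; first by rewrite !size_cat addnC.
by move=> f; rewrite !walk_edges_cat lp2 !mem_cat orbC.
Qed.

Lemma trail_extend F x p z : is_trail (edge_rel F) x p -> z != last x p ->
  [set last x p; z]%SET \in F -> [set last x p; z]%SET \notin walk_edges x p ->
  is_trail (edge_rel F) x (rcons p z).
Proof.
move=> /andP[ep uq] zl zF zN; rewrite /is_trail rcons_path ep /=.
by rewrite /edge_rel /= eq_sym zl zF -cats1 walk_edges_cat cats1 rcons_uniq zN.
Qed.

Lemma edge_decomp f v : #|f| = 2 -> v \in f ->
  exists2 z, z != v & f = [set v; z]%SET.
Proof.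
move=> /eqP/cards2P[a [b [ab ->]]]; rewrite !inE => /orP[]/eqP->.
  by exists b => //; rewrite eq_sym.
by exists a => //; rewrite setUC.
Qed.

Lemma longest_trail_closed F x p : {in F, forall f, #|f| = 2} -> even_graph F ->
  is_trail (edge_rel F) x p ->
  (forall q, is_trail (edge_rel F) x q -> size q <= size p) ->
  is_circuit (edge_rel F) x p.
Proof.
move=> F2 evF tr maxp; rewrite /is_circuit tr /=; apply: contraT => lx.
have /andP[ep uq] := tr.
pose y := last x p.
suff [f [fF yf fN]] : exists f, [/\ f \in F, y \in f & f \notin walk_edges x p].
  have [z zy fE] := edge_decomp (F2 _ fF) yf.
  rewrite fE in fF fN.
  have := maxp _ (trail_extend tr zy fF fN).
  by rewrite size_rcons ltnn.
apply/not_existsP => all_used.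
have := odd_count_walk_edges y (edge_rel_irr F) ep.
rewrite eqxx -/y (negbTE lx) /=.
suff -> : count (fun f : {set T} => y \in f) (walk_edges x p) = edge_deg F y.
  by rewrite (negbTE (forallP evF y)).
rewrite -size_filter /edge_deg cardE; apply/perm_size/uniq_perm.
- exact: filter_uniq.
- exact: enum_uniq.
move=> f; rewrite mem_filter mem_enum inE andbC.
case yf: (y \in f); rewrite ?andbF //= !andbT.
apply/idP/idP => [/(walk_edges_sub ep)//|fF].
by apply: contraT => fN; case: (all_used f).
Qed.

Lemma euler_circuit F x : {in F, forall f, #|f| = 2} -> even_graph F ->
  exists y p, is_circuit (edge_rel F) y p /\
   [set f in F | [exists u, (u \in f) && connect (edge_rel F) x u]]%SET
     \subset walk_edges y p.
Proof.
move=> F2 evF.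
(* The start of the trail ranges over the whole component of [x], so that rotations of a longest
   trail compete with it. *)
pose P m := `[< exists y p, [/\ connect (edge_rel F) x y,
  is_trail (edge_rel F) y p & size p = m] >].
have exP : exists m, P m by exists 0; apply/asboolP; exists x, [::].
have ubP m : P m -> m <= #|{set T}|.
  move=> /asboolP[y [p [_ /andP[_ uq] <-]]].
  by rewrite -(size_walk_edges y) -(card_uniqP uq) max_card.
case: (ex_maxnP exP ubP) => m /asboolP[y [p [xy tr <-]]] maxm.
have maxq z q : connect (edge_rel F) x z -> is_trail (edge_rel F) z q ->
    size q <= size p.
  by move=> xz tq; apply: maxm; apply/asboolP; exists z, q.
have cir : is_circuit (edge_rel F) y p.
  by apply: longest_trail_closed => // q; apply: maxq.
exists y, p; split=> //.
have /andP[ep _] := tr.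
have xall z : z \in y :: p -> connect (edge_rel F) x z.
  by move=> zp; apply: connect_trans xy (path_connect ep zp).
(* Otherwise the circuit, rotated to start and end at [z], could be extended by [f]. *)
have used z f : z \in y :: p -> f \in F -> z \in f -> f \in walk_edges y p.
  move=> zp fF zf; apply: contraT => fN.
  have [q qcir [sq eq]] := is_circuit_rot cir zp.
  have [w wz fE] := edge_decomp (F2 _ fF) zf.
  have /andP[qtr /eqP lq] := qcir.
  have : is_trail (edge_rel F) z (rcons q w).
    by apply: trail_extend; rewrite ?lq // -?fE // eq.
  by move/(maxq _ _ (xall _ zp)); rewrite size_rcons sq ltnn.
(* Since all edges at visited vertices are used, the visited set is closed under adjacency and
   contains the component. *)
have clos : fingraph.closed (edge_rel F) (mem (y :: p)).
  apply: (intro_closed (sym_connect_sym (@edge_rel_sym F))) => u v uv up.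
  move: uv => /= /andP[_ uvF].
  by apply: (walk_edges_vertices (used u _ up uvF _)); rewrite !inE eqxx ?orbT.
apply/subsetP => f; rewrite inE => /andP[fF /existsP[u /andP[uf xu]]].
apply: used fF uf.
have := closed_connect clos xu; have := closed_connect clos xy.
by rewrite /= => -> <-; apply: mem_head.
Qed.

(** The fibre of [h] over an edge consists of at most its two orientations. *)
Lemma edge_pairs_card F : #|[set uv : T * T | edge_rel F uv.1 uv.2]%SET| <= #|F| * 2.
Proof.
pose h (uv : T * T) := [set uv.1; uv.2]%SET.
rewrite -sum1_card (partition_big h (fun f => f \in F)) /=; last first.
  by move=> uv; rewrite inE => /andP[].
rewrite -sum_nat_const; apply: leq_sum => f fF.
rewrite sum1dep_card.
case: (pickP (fun uv : T * T => (uv \in [set uv : T * T | edge_rel F uv.1 uv.2]%SET)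
   && (h uv == f))) => [[a b]|none]; last first.
  by rewrite (eq_card0 (A := [set x | _]%SET)) // => uv; rewrite inE; apply: none.
rewrite inE /= => /andP[/andP[ab _] /eqP fE].
apply: (@leq_trans #|[set (a, b); (b, a)]%SET|); last by rewrite cards2; case: eqP.
apply/subset_leq_card/subsetP => -[u v]; rewrite !inE /= => /andP[/andP[uv _] /eqP].
rewrite -fE /h /= => /setP E.
have := E u; have := E v; have := E a; have := E b; rewrite !inE !eqxx ?orbT /=.
rewrite !xpair_eqE.
by move: uv ab; do ?[case: eqVneq => //= ?; subst=> //=];
   rewrite ?eqxx ?orbT ?orbF ?andbT ?andbF.
Qed.

End EvenGraphs.

(** * Components of two relations that together cover almost all pairs *)

Section TwoRelations.
Import mathcomp.boot.fintype mathcomp.boot.finset.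
Variable T : finType.
Implicit Types (r b e : rel T).
Let n := #|T|.

(** Here and in [component_pairs] the pairs are ordered, so each edge of a graph counts twice. *)
Definition missing_pairs r b :=
  [set uv : T * T | [&& uv.1 != uv.2, ~~ r uv.1 uv.2 & ~~ b uv.1 uv.2]]%SET.

Definition component e x := [set u | connect e x u]%SET.

Definition component_pairs e x :=
  [set uv : T * T | e uv.1 uv.2 && connect e x uv.1]%SET.

Lemma card_pairs (Q : T -> T -> bool) :
  #|[set uv : T * T | Q uv.1 uv.2]%SET| = \sum_u #|[set v | Q u v]%SET|.
Proof.
rewrite -sum1_card big_mkcond /=.
under [RHS]eq_bigr => u _ do rewrite -sum1_card big_mkcond.
by rewrite pair_bigA /=; apply: eq_bigr => -[u v] _; rewrite !inE.
Qed.

Lemma missing_pairsC r b : missing_pairs r b = missing_pairs b r.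
Proof. by apply/setP => uv; rewrite !inE [~~ r _ _ && _]andbC. Qed.

(** Take the components [A] and [B] of one vertex [v]. A pair from [A :\: B] and [B :\: A] is joined
    by neither relation, so the product of their sizes is at most [4 * n] and the smaller one is
    O(sqrt n). *)
Lemma almost_spanning_component r b : symmetric b -> 0 < n -> #|missing_pairs r b| <= 4 * n ->
  exists v w, w * w <= 4 * n /\
   (#|~: component r v| <= w + 4 \/ #|~: component b v| <= w + 4).
Proof.
move=> symb n0 few.
(* Averaging: five missing pairs at every vertex would give [5 * n] in total. *)
have [v dv] : exists v,
    #|[set u | [&& v != u, ~~ r v u & ~~ b v u]]%SET| <= 4.
  apply/not_existsP => many; move: few; apply/negP; rewrite -ltnNge.
  rewrite /missing_pairs (card_pairs (fun u v => [&& u != v, ~~ r u v & ~~ b u v])).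
  apply: (@leq_trans (\sum_(u : T) 5)).
    by rewrite sum_nat_const -/n; lia.
  by apply: leq_sum => u _; rewrite ltnNge; apply/negP/many.
pose A := component r v; pose B := component b v.
have outAB : #|~: (A :|: B)| <= 4.
  apply: leq_trans dv; apply/subset_leq_card/subsetP => u.
  rewrite !inE negb_or => /andP[rvu bvu]; apply/and3P; split.
  - by apply: contraNneq rvu => ->; apply: connect0.
  - by apply: contra rvu; apply: connect1.
  - by apply: contra bvu; apply: connect1.
have PQ : #|A :\: B| * #|B :\: A| <= 4 * n.
  rewrite -cardsX; apply: leq_trans few; apply/subset_leq_card/subsetP => -[p q].
  rewrite !inE /= => /andP[/andP[nbp rp] /andP[nrq bq]]; apply/and3P; split.
  - by apply: contraNneq nrq => <-.
  - by apply: contra nrq => rpq; apply: connect_trans rp (connect1 rpq).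
  - apply: contra nbp => bpq; apply: connect_trans bq _.
    by apply: connect1; rewrite symb.
have coverA : #|~: A| <= #|B :\: A| + #|~: (A :|: B)|.
  apply: leq_trans (leq_card_setU _ _).1; apply/subset_leq_card/subsetP => u.
  by rewrite !inE; case: (connect r v u); case: (connect b v u).
have coverB : #|~: B| <= #|A :\: B| + #|~: (A :|: B)|.
  apply: leq_trans (leq_card_setU _ _).1; apply/subset_leq_card/subsetP => u.
  by rewrite !inE; case: (connect r v u); case: (connect b v u).
exists v, (minn #|A :\: B| #|B :\: A|); split.
  by apply: leq_trans PQ; rewrite leq_mul ?geq_minl ?geq_minr.
by case: (leqP #|A :\: B| #|B :\: A|) => le; [right|left]; rewrite -/A -/B; lia.
Qed.

(* With [t := s + 5] and [x := bt / m], the hypotheses say, up to O(t / m),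
   that x >= 5/9 and x (1 - x) <= 2/9, whence x >= 2/3 - O(t / m). *)
Lemma density_arith (m s rho bt NR NB : nat) : bt <= m ->
  rho <= NR + s * m ->
  2 * (bt * (m - bt)) <= rho + 4 * m ->
  m * m <= m * bt + (rho + 4 * m) ->
  m * m <= m + 4 * m + rho + NB + (m - bt) * (m - bt) ->
  4 * (m * m) <= 9 * NR + 72 * ((s + 5) * m) \/
  4 * (m * m) <= 9 * NB + 72 * ((s + 5) * m).
Proof.
move=> btm h1 h2 h3 h4.
have [|ltNR] := leqP (4 * (m * m)) (9 * NR + 72 * ((s + 5) * m)); first by left.
(* For such small [m] the error term alone exceeds [4 * (m * m)]. From here on t < m / 9, where t =
   s + 5. *)
right; have [mt|tm] := leqP m (9 * (s + 5)); first by nia.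
have [g gE] : exists g, g = m - bt by exists (m - bt).
have btE : bt = m - g by lia.
have gm : g <= m by lia.
rewrite -gE in h2 h4; subst bt; clear gE btm.
have {}ltNR : 9 * NR < 4 * (m * m) by nia.
have h5 : 9 * rho <= 4 * (m * m) + 9 * (s * m) by lia.
have h6 : 9 * g <= 5 * m.
  have : 9 * (m * g) <= 4 * (m * m) + 9 * ((s + 5) * m) by nia.
  nia.
(* If 3g > m, the bound on g(m - g) reads 2(3g - m)(2m - 3g) <= 9tm, and [h6] gives 2m - 3g >=
   m/3. *)
have h7 : 6 * g <= 2 * m + 27 * (s + 5).
  have [?|lt] := leqP (3 * g) m; first by lia.
  have : 18 * ((m - g) * g) <= 4 * (m * m) + 9 * ((s + 5) * m) by lia.
  nia.
(* Squaring [h7] leaves a term in t^2, which t < m / 9 turns into a multiple of tm. *)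
have h8 : 9 * (g * g) <= m * m + 50 * ((s + 5) * m) by nia.
nia.
Qed.

(** The candidates are the nearly spanning [r]-component of [v] and a largest [b]-component [D];
    four pair counts feed [density_arith]. *)
Lemma dense_component r b v s : symmetric b -> #|missing_pairs r b| <= 4 * n ->
  #|~: component r v| <= s -> 0 < n ->
  exists x, 4 * (n * n) <= 9 * #|component_pairs r x| + 72 * ((s + 5) * n) \/
            4 * (n * n) <= 9 * #|component_pairs b x| + 72 * ((s + 5) * n).
Proof.
move=> symb few sv n0.
have csym := sym_connect_sym symb.
case: (@arg_maxnP _ v predT (fun u => #|component b u|) isT) => u _ maxu.
pose D := component b u; pose rho := #|[set uv : T * T | r uv.1 uv.2]%SET|.
pose N := [set uv : T * T | ~~ connect b uv.1 uv.2]%SET.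
(* A pair separated by the [b]-components is not in [b], hence is in [r] or missing. *)
have cN : #|N| <= rho + 4 * n.
  apply: leq_trans (leq_add (leqnn _) few).
  apply: leq_trans (leq_card_setU _ _).1; apply/subset_leq_card/subsetP => -[p q].
  rewrite !inE /= => nb; case: (r p q) => //=; apply/andP; split.
    by apply: contra nb => /eqP ->; apply: connect0.
  by apply: contra nb; apply: connect1.
have cDC : #|~: D| = n - #|D| by rewrite cardsCs setCK.
suff [h|h] : 4 * (n * n) <= 9 * #|component_pairs r v| + 72 * ((s + 5) * n) \/
    4 * (n * n) <= 9 * #|component_pairs b u| + 72 * ((s + 5) * n).
- by exists v; left.
- by exists u; right.
apply: (@density_arith n s rho #|D|); first exact: max_card.
(* An [r]-pair outside the component of [v] starts at one of at most [s] vertices. *)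
- apply: (@leq_trans (#|component_pairs r v| + #|setX (~: component r v) [set: T]|)).
    apply: leq_trans (leq_card_setU _ _).1; apply/subset_leq_card/subsetP => -[p q].
    by rewrite !inE /= => ->; rewrite andbT orbN.
  by rewrite leq_add2l cardsX cardsT leq_mul2r sv orbT.
(* The pairs between [D] and its complement, in both orders, are separated. *)
- apply: leq_trans cN; rewrite -cDC mul2n -addnn -{1}cardsX mulnC -cardsX.
  rewrite -cardsUI (_ : (_ :&: _) = set0) ?cards0 ?addn0; last first.
    by apply/setP => -[p q]; rewrite !inE /=; case: connect; case: connect.
  apply/subset_leq_card/subsetP => -[p q]; rewrite !inE /= => /orP[]/andP[up uq].
    by apply: contra uq; apply: connect_trans.
  by apply: contra up; rewrite csym; apply: connect_trans.
(* By maximality of [D], each vertex is [b]-connected to at most [#|D|] vertices. *)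
- apply: (@leq_trans (#|~: N| + #|N|)).
    by rewrite addnC cardsC card_prod.
  rewrite leq_add // -[n * #|D|]sum_nat_const.
  rewrite (_ : ~: N = [set uv : T * T | connect b uv.1 uv.2]%SET); last first.
    by apply/setP => uv; rewrite !inE negbK.
  by rewrite (card_pairs (connect b)); apply: leq_sum => w _; apply: maxu.
(* Every pair is diagonal, missing, in [r], a [b]-pair in [D], or has both ends outside [D]. *)
- pose diag := [set (w, w) | w : T]%SET.
  have cdiag : #|diag| = n by rewrite card_imset // => w1 w2 [].
  rewrite -cDC -cardsX -[X in X <= _](card_prod T T) -cardsT.
  apply: (@leq_trans #|diag :|: missing_pairs r b :|: [set uv : T * T | r uv.1 uv.2]%SET
     :|: component_pairs b u :|: setX (~: D) (~: D)|).
    apply/subset_leq_card/subsetP => -[p q] _; rewrite !inE /=.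
    case: (eqVneq p q) => [->|_]; first by rewrite imset_f.
    case: (r p q); rewrite ?orbT //=.
    case bpq: (b p q); rewrite ?orbT //=.
    case up: (connect b u p); rewrite ?orbT //= !orbF.
    apply/orP; right; apply: contraFN up => uq; apply: connect_trans uq _.
    by apply: connect1; rewrite symb.
  have leU (X Y : {set T * T}) a c : #|X| <= a -> #|Y| <= c -> #|X :|: Y| <= a + c.
    by move=> Xa Yc; apply: leq_trans (leq_card_setU _ _).1 (leq_add Xa Yc).
  apply: (leU) => //; apply: (leU) => //; apply: (leU) => //.
  by apply: (leU) => //; rewrite cdiag.
Qed.

End TwoRelations.

(** * Long monochromatic circuits in an arbitrary colouring *)

Section Colourings.
Import mathcomp.boot.fintype mathcomp.boot.finset.
Variables (n : nat) (c : two_colouring n).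

Definition colour_class (k : bool) := [set f : {set 'I_n} | (#|f| == 2) && (c f == k)]%SET.

Lemma colour_class_circuit k (F : {set {set 'I_n}}) x :
  F \subset colour_class k -> even_graph F ->
  exists y p, mono_circuit c y p /\ #|component_pairs (edge_rel F) x| <= size p * 2.
Proof.
move=> /subsetP Fk evF.
have F2 : {in F, forall f : {set 'I_n}, #|f| = 2} by move=> f /Fk; rewrite inE => /andP[/eqP].
have [y [p [/andP[/andP[ep uq] lp] cov]]] := euler_circuit x F2 evF.
exists y, p; split.
  rewrite /mono_circuit /is_circuit /is_trail uq lp !andbT.
  apply/andP; split; first by apply: sub_path ep => u w /andP[].
  apply/(@all_pred1_constant _ k)/allP => _ /mapP[f /(walk_edges_sub ep)/Fk + ->].
  by rewrite inE => /andP[].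
set G := [set f in F | _]%SET in cov.
apply: (@leq_trans (#|G| * 2)); last first.
  by rewrite leq_mul2r -(size_walk_edges y) -(card_uniqP uq) subset_leq_card ?orbT.
apply: leq_trans (edge_pairs_card G); apply/subset_leq_card/subsetP => -[u w].
rewrite !inE /= => /andP[/andP[uw uwF] xu]; rewrite /edge_rel /= uw inE uwF /=.
by apply/existsP; exists u; rewrite !inE eqxx.
Qed.

Lemma long_mono_circuit : 0 < n -> exists y p w, [/\ mono_circuit c y p,
  w * w <= 4 * n & 4 * (n * n) <= 18 * size p + 72 * ((w + 9) * n)].
Proof.
move=> n0.
have [F1 [sub1 ev1 few1]] := large_even_subgraph (colour_class true).
have [F0 [sub0 ev0 few0]] := large_even_subgraph (colour_class false).
pose M := (colour_class true :\: F1) :|: (colour_class false :\: F0).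
(* Each colour class loses at most [n] edges, and each lost edge gives two ordered pairs. *)
have few : #|missing_pairs (edge_rel F1) (edge_rel F0)| <= 4 * #|'I_n|.
  apply: (@leq_trans (#|M| * 2)).
    apply: leq_trans (edge_pairs_card M).
    apply/subset_leq_card/subsetP => -[u v]; rewrite !inE /edge_rel /= !inE.
    case/and3P => uv; rewrite uv /= => -> ->; rewrite cards2 uv /=.
    by case: (c _).
  have := leq_trans (leq_card_setU _ _).1 (leq_add few1 few0).
  by rewrite -/M addnn -mul2n muln2 -mul2n (_ : 4 = 2 * 2) // -mulnA leq_pmul2l.
have sym1 := @edge_rel_sym _ F1; have sym0 := @edge_rel_sym _ F0.
have cn : 0 < #|'I_n| by rewrite card_ord.
have [v [w [ww side]]] := almost_spanning_component sym0 cn few.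
have [x [h|h]] : exists x,
    4 * (#|'I_n| * #|'I_n|) <= 9 * #|component_pairs (edge_rel F1) x|
       + 72 * ((w + 4 + 5) * #|'I_n|) \/
    4 * (#|'I_n| * #|'I_n|) <= 9 * #|component_pairs (edge_rel F0) x|
       + 72 * ((w + 4 + 5) * #|'I_n|).
  (* If the nearly spanning component belongs to [F0], the two colours exchange roles. *)
  case: side => side; first exact: (dense_component sym0 few side cn).
  rewrite missing_pairsC in few.
  have [x [h|h]] := dense_component sym1 few side cn; exists x; first by right.
  by left.
- have [y [p [cir le]]] := colour_class_circuit x sub1 ev1.
  by exists y, p, w; rewrite card_ord in ww h; split => //; lia.
- have [y [p [cir le]]] := colour_class_circuit x sub0 ev0.
  by exists y, p, w; rewrite card_ord in ww h; split => //; lia.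
Qed.

End Colourings.

(** * The extremal colouring *)

Section TwoCliques.
Import mathcomp.boot.fintype mathcomp.boot.finset.
Variables (n k : nat).

Let A := [set i : 'I_n | i < k]%SET.

Definition two_cliques : two_colouring n := fun f => (f \subset A) || (f \subset ~: A).

Lemma two_cliques_edge u v :
  two_cliques [set u; v]%SET = ((u \in A) == (v \in A)).
Proof.
by rewrite /two_cliques !subUset !sub1set !inE; case: (u < k); case: (v < k).
Qed.

Lemma card_initial_segment : k <= n -> #|A| = k.
Proof.
move=> kn; have -> : A = [set widen_ord kn i | i in [set: 'I_k]]%SET.
  apply/setP => i; rewrite inE; apply/idP/imsetP => [ik|[[j jk] _ ->]]; last by [].
  by exists (Ordinal ik) => //; apply: val_inj.
rewrite card_imset ?cardsT ?card_ord // => i j /(congr1 val) /= ij.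
exact: val_inj.
Qed.

(** A trail repeats no edge, so its length is at most the number of edges of any graph containing
    it: here one of the two cliques, or the bipartite graph between them. *)
Lemma two_cliques_trail x p : k <= n -> mono_trail two_cliques x p ->
  [\/ size p <= 'C(k, 2), size p <= 'C(n - k, 2) | size p <= k * (n - k)].
Proof.
move=> kn /andP[/andP[ep uq] mono].
have cA := card_initial_segment kn.
have cAC : #|~: A| = n - k by rewrite cardsCs setCK card_ord cA.
have bound (G : {set {set 'I_n}}) : {subset walk_edges x p <= G} -> size p <= #|G|.
  move=> sub; rewrite -(size_walk_edges x) -(card_uniqP uq).
  by apply/subset_leq_card/subsetP.
have all2 f : f \in walk_edges x p -> #|f| == 2.
  elim: p x ep {uq mono bound} => //= y p IHp x /andP[xy yp].
  by rewrite inE => /predU1P[->|/(IHp _ yp)//]; rewrite cards2 (xy : x != y).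
have [col colE] : exists col, {in walk_edges x p, forall f, two_cliques f = col}.
  move: mono; rewrite /monochromatic; case: (walk_edges x p) => [|f s] /=.
    by exists true.
  move=> /allP al; exists (two_cliques f) => g; rewrite inE => /predU1P[->//|gs].
  by apply/eqP/al/map_f.
case: col colE => colE.
  have side f : f \in walk_edges x p -> forall v, v \in f -> (v \in A) = (x \in A).
    elim: p x colE {ep uq mono bound all2} => //= y p IHp x colE.
    have xy : (x \in A) = (y \in A).
      by apply/eqP; rewrite -two_cliques_edge; exact: colE (mem_head _ _).
    rewrite inE => /predU1P[-> v|fp v vf].
      by rewrite in_set2 => /orP[]/eqP->.
    rewrite xy; apply: IHp vf => // g gp; apply: colE.
    by rewrite inE gp orbT.
  case xA: (x \in A); [apply: Or31; rewrite -cA|apply: Or32; rewrite -cAC];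
    rewrite -cards_draws; apply: bound => f fp; rewrite inE all2 // andbT;
    apply/subsetP => v vf; rewrite ?in_setC (side f) // xA //.
apply: Or33; rewrite -{1}cA -cAC -cardsX.
pose h (uv : 'I_n * 'I_n) := [set uv.1; uv.2]%SET.
apply: leq_trans (leq_imset_card h _); apply: bound => f fp.
have /cards2P[u [v [_ fE]]] := all2 _ fp.
move: (colE _ fp); rewrite fE two_cliques_edge => /negbT uv.
case uA: (u \in A) uv => uv.
  by apply/imsetP; exists (u, v) => //; rewrite inE /= uA in_setC; case: (v \in A) uv.
apply/imsetP; exists (v, u); last by rewrite /h /= setUC.
by rewrite inE /= in_setC uA; case: (v \in A) uv.
Qed.

End TwoCliques.


(** * Asymptotic estimates and the two bounds *)

Local Open Scope classical_set_scope.
Local Open Scope ring_scope.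

Lemma powR32 (R : realType) (x : R) : 0 <= x -> x `^ (3 / 2) = x * Num.sqrt x.
Proof.
move=> x0; rewrite -powR12_sqrt // (_ : 3 / 2 = 1 + 2^-1 :> R); last by field.
(* The rule for adding exponents is applied to a nonzero base; at 0 both sides vanish. *)
have [->|xn0] := eqVneq x 0; last by rewrite powRD ?xn0 ?implybT // powRr1.
by rewrite mul0r powR0 //; lra.
Qed.

Lemma linear_littleo_square (R : realType) :
  (fun n : nat => n%:R + 1 : R) =o_\oo (fun n : nat => n%:R ^+ 2 : R).
Proof.
apply/eqoP => eps eps0; near=> n.
have n1 : 1 <= n%:R :> R by rewrite ler1n; near: n; exact: nbhs_infty_gt.
(* Then n + 1 <= 2n <= eps n^2. *)
have n2 : 2 / eps <= n%:R by near: n; exact: nbhs_infty_ger.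
rewrite !ger0_norm ?exprn_ge0 //; try lra.
rewrite ler_pdivrMr // in n2; rewrite expr2 mulrA; nra.
Unshelve. all: by end_near.
Qed.

Lemma bin2_le (R : realType) (k : nat) : ('C(k, 2))%:R <= k%:R ^+ 2 / 2 :> R.
Proof.
have : ('C(k, 2) * 2 <= k * k)%N.
  rewrite bin2 muln2 (@leq_trans (k * k.-1)) ?leq_mul2l ?leq_pred ?orbT //.
  by rewrite -[leqRHS]odd_double_half leq_addl.
rewrite -(ler_nat R) !natrM expr2; lra.
Qed.

Theorem theorem1 (R : realType) :
  (exists2 E : nat -> R,
     exists C : R, forall n : nat, `|E n| <= C * n%:R `^ (3 / 2)
   & forall (n : nat) (c : two_colouring n), (0 < n)%N ->
       (exists (x : 'I_n) (p : seq 'I_n),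
          mono_circuit c x p /\ 2 * n%:R ^+ 2 / 9 + E n <= (size p)%:R) /\
       (exists (x : 'I_n) (p : seq 'I_n),
          mono_trail c x p /\ 2 * n%:R ^+ 2 / 9 + E n <= (size p)%:R))
  /\
  (exists2 E : nat -> R,
     E =o_\oo (fun n : nat => n%:R ^+ 2 : R)
   & forall n : nat, exists c : two_colouring n,
       forall (x : 'I_n) (p : seq 'I_n),
         (mono_trail c x p -> (size p)%:R <= 2 * n%:R ^+ 2 / 9 + E n) /\
         (mono_circuit c x p -> (size p)%:R <= 2 * n%:R ^+ 2 / 9 + E n)).
Proof.
split.
  (* With q = sqrt n >= 1 one has w + 9 <= 11q, and 72 * 11 / 18 = 44. *)
  exists (fun n => - (44 * n%:R `^ (3 / 2))).
    exists 44 => n; rewrite normrN ger0_norm // mulr_ge0 //; exact: powR_ge0.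
  move=> n c n0.
  suff [x [p [cir le]]] : exists (x : 'I_n) (p : seq 'I_n), mono_circuit c x p /\
      2 * n%:R ^+ 2 / 9 + - (44 * n%:R `^ (3 / 2)) <= (size p)%:R :> R.
    split; exists x, p; split=> //.
    by case/andP: cir => /andP[tr _] mono; apply/andP.
  have [x [p [w [cir ww le]]]] := long_mono_circuit c n0.
  exists x, p; split=> //; rewrite powR32 //.
  set q := Num.sqrt n%:R.
  have q0 : 0 <= q by exact: sqrtr_ge0.
  have qq : q ^+ 2 = n%:R by rewrite sqr_sqrtr.
  have q1 : 1 <= q by rewrite -sqrtr1 ler_sqrt // ler1n.
  have wq : w%:R <= 2 * q.
    rewrite -(ler_pXn2r (n := 2)) ?nnegrE ?mulr_ge0 //.
    rewrite exprMn qq expr2 -natrM -natrX -natrM ler_nat.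
    by apply: leq_trans ww _.
  move: le; rewrite -(ler_nat R) !(natrM, natrD) => le.
  have : (w%:R + 9) * n%:R <= 11 * q * n%:R :> R by rewrite ler_wpM2r //; lra.
  by rewrite expr2; move: le; set a := (_ + 9%:R) * _; lra.
(* The linear term absorbs the rounding of 2n/3 to [k]; the larger clique and the bipartite graph
   both have about 2n^2/9 edges. *)
exists (fun n => n%:R + 1); first exact: linear_littleo_square.
move=> n; pose k := ((2 * n) %/ 3)%N.
have kn : (k <= n)%N by rewrite /k; lia.
have k1 : 3 * k%:R <= 2 * n%:R :> R by rewrite -!natrM ler_nat /k; lia.
have k2 : 2 * n%:R <= 3 * k%:R + 2 :> R.
  by rewrite -!natrM -natrD ler_nat /k; lia.
exists (@two_cliques n k) => x p.
suff main : mono_trail (@two_cliques n k) x p ->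
    (size p)%:R <= 2 * n%:R ^+ 2 / 9 + (n%:R + 1) :> R.
  split=> // /andP[/andP[tr _] mono]; apply: main; exact/andP.
have n0 : 0 <= n%:R :> R by [].
have k0 : 0 <= k%:R :> R by [].
move=> /(two_cliques_trail kn)[]; rewrite -(ler_nat R) => le.
- apply: le_trans le _; apply: le_trans (bin2_le R k) _; nra.
- apply: le_trans le _; apply: le_trans (bin2_le R (n - k)) _.
  rewrite natrB //; nra.
- apply: le_trans le _; rewrite natrM natrB //; nra.
Qed.
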